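(* Let $n,m,M$ be positive integers, let $A_1,\dots,A_M\in\mathbb{R}^{n\times n}$, $B\in\mathbb{R}^{n\times m}$, $\mathcal{M}=\{1,\dots,M\}$, and consider the switched linear system $x(t+1)=A_{\sigma(t)}x(t)+Bu(t)$, $t\in\mathbb{Z}^+$, with arbitrary switching signal $\sigma:\mathbb{Z}^+\to\mathcal{M}$. Given $N\in\mathbb{Z}^+$, let $\omega_N=\{(x_i,\sigma_i)\}_{i=1}^N\subset\mathbb{S}\times\mathcal{M}$ be i.i.d. with respect to the uniform distribution $\mathbb{P}$ over $\mathbb{S}\times\mathcal{M}$, and let $\gamma(\omega_N)$, $P(\omega_N)$, $K(\omega_N)$ be the output of Algorithm 1 (described in the context) run on $\omega_N$, $B$ and some tolerance $\epsilon_{tol}>0$. Then, for any $\epsilon\in(0,1)$, with probability no smaller than $1-\mathcal{B}(\epsilon;N)$, the joint spectral radius of the closed-loop system $x(t+1)=(A_{\sigma(t)}+BK)x(t)$ with $K=K(\omega_N)$ satisfies $$\rho(\mathcal{A}_{K(\omega_N)})\le \frac{\gamma(\omega_N)}{1-\kappa(P(\omega_N))\bigl(1-\cos(\delta^{-1}(\epsilon))\bigr)},$$ where $$\mathcal{B}(\epsilon;N)=\frac{M\left(1-\frac{\delta\left(\frac12\delta^{-1}(\epsilon)\right)}{M}\right)^N}{\delta\left(\frac14\delta^{-1}(\epsilon)\right)},$$ with the convention that if $\kappa(P(\omega_N))(1-\cos(\delta^{-1}(\epsilon)))\ge 1$ the right-hand side of the bound is $+\infty$.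
   Context: $\mathbb{S}$ is the unit sphere in $\mathbb{R}^n$ and $\mu$ the uniform (rotation-invariant) probability measure on $\mathbb{S}$. The uniform distribution on $\mathbb{S}\times\mathcal{M}$ is the product of $\mu$ and the uniform distribution on $\mathcal{M}$. For $x\in\mathbb{S}$ and $\theta\in[0,\pi/2]$, $\mathrm{Cap}(x,\theta)=\{v\in\mathbb{S}:|x^\top v|\ge\cos\theta\}$, and $\delta(\theta)=\mu(\mathrm{Cap}(x,\theta))$ (independent of $x$); $\delta$ is strictly increasing from $[0,\pi/2]$ onto $[0,1]$ and $\delta^{-1}$ denotes its inverse. For $P\succ0$, $\kappa(P)=\lambda_{\max}(P)/\lambda_{\min}(P)$. For $K\in\mathbb{R}^{m\times n}$, $\mathcal{A}_K=\{A_1+BK,\dots,A_M+BK\}$ and its joint spectral radius is $\rho(\mathcal{A}_K)=\lim_{k\to\infty}\max_{(\sigma_0,\dots,\sigma_{k-1})\in\mathcal{M}^k}\|(A_{\sigma_{k-1}}+BK)\cdots(A_{\sigma_0}+BK)\|^{1/k}$. Algorithm 1 (uses only $B$, the sample points $x$ and the observed successors $A_\sigma x$ for $(x,\sigma)\in\omega_N$): define Problem (K-step) for fixed $P$: minimize $\gamma\ge0$ over $(\gamma,K)$ subject to $\begin{pmatrix}\gamma^2x^\top Px & (A_\sigma x+BKx)^\top P\\ P(A_\sigma x+BKx) & P\end{pmatrix}\succeq0$ for all $(x,\sigma)\in\omega_N$. Define Problem (P-step) for fixed $K$: minimize $\gamma\ge0$ over $(\gamma,P)$ subject to $(A_\sigma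 x+BKx)^\top P(A_\sigma x+BKx)\le\gamma^2x^\top Px$ for all $(x,\sigma)\in\omega_N$ and $P\succeq I$. Initialize $k=0$, $P_0=I_n$, and $(K_0,\gamma_0)$ a solution of (K-step) with $P=P_0$. Iterate: obtain $P_{k+1}$ from (P-step) with $K=K_k$; obtain $(K_{k+1},\gamma_{k+1})$ from (K-step) with $P=P_{k+1}$; if $|\gamma_{k+1}-\gamma_k|<\epsilon_{tol}$, output $\gamma(\omega_N)=\gamma_{k+1}$, $P(\omega_N)=P_{k+1}$, $K(\omega_N)=K_{k+1}$ and stop; otherwise set $k\leftarrow k+1$ and repeat. *)

(* Defs.v *)
From HB Require Import structures.
From mathcomp Require Import all_boot all_order all_algebra.
From mathcomp Require Import all_classical all_reals all_analysis.
Import Order.TTheory GRing.Theory Num.Theory.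
Import numFieldNormedType.Exports.

Set Implicit Arguments.
Unset Strict Implicit.
Unset Printing Implicit Defensive.

Local Open Scope classical_set_scope.
Local Open Scope ring_scope.

Section Defs.
Variable R : realType.

Definition Rn (n : nat) := g_sigma_algebraType (@open 'cV[R]_n).

Definition enorm n (x : 'cV[R]_n) : R := Num.sqrt ((x^T *m x) 0 0).
Definition sphere n : set 'cV[R]_n := [set x | enorm x = 1].

Definition orthogonal_mx n (Q : 'M[R]_n) : Prop := Q^T *m Q = 1%:M.

Definition uniform_on_sphere n (mu : probability (Rn n) R) : Prop :=
  mu (~` (@sphere n : set (Rn n))) = 0%E /\
  forall (Q : 'M[R]_n), orthogonal_mx Q ->
  forall A : set (Rn n), measurable A ->
    mu ((fun x : Rn n => (Q *m x : Rn n)) @^-1` A) = mu A.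

Definition Cap n (x : 'cV[R]_n) (theta : R) : set 'cV[R]_n :=
  [set v | @sphere n v /\ cos theta <= `|(x^T *m v) 0 0|].

Definition e0 n : 'cV[R]_n := \col_i ((i : nat) == 0%N)%:R.

Definition delta n (mu : probability (Rn n) R) (theta : R) : R :=
  fine (mu (Cap (@e0 n) theta : set (Rn n))).

Definition delta_inv n (mu : probability (Rn n) R) (eps : R) : R :=
  xget 0 [set theta | 0 <= theta <= pi / 2 /\ delta mu theta = eps].

Definition Bbound n (mu : probability (Rn n) R) (M N : nat) (eps : R) : R :=
  M%:R * (1 - delta mu (delta_inv mu eps / 2) / M%:R) ^+ N
    / delta mu (delta_inv mu eps / 4).

Definition psd k (S : 'M[R]_k) : Prop :=
  S^T = S /\ forall z : 'cV[R]_k, 0 <= (z^T *m S *m z) 0 0.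

Definition qf n (P : 'M[R]_n) (x : 'cV[R]_n) : R := (x^T *m P *m x) 0 0.

Section Algo.
Variables (n m M N : nat) (A : 'I_M -> 'M[R]_n) (B : 'M[R]_(n, m))
  (xs : 'I_N -> 'cV[R]_n) (ss : 'I_N -> 'I_M).

Definition succ (K : 'M[R]_(m, n)) (i : 'I_N) : 'cV[R]_n :=
  A (ss i) *m xs i + B *m K *m xs i.

Definition Kstep_feasible (P : 'M[R]_n) (g : R) (K : 'M[R]_(m, n)) : Prop :=
  0 <= g /\ forall i : 'I_N,
    psd (block_mx ((g ^+ 2 * qf P (xs i))%:M : 'M[R]_1) ((succ K i)^T *m P)
                  (P *m succ K i) P).
Definition Kstep_solution (P : 'M[R]_n) (g : R) (K : 'M[R]_(m, n)) : Prop :=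
  Kstep_feasible P g K /\
  forall g' K', Kstep_feasible P g' K' -> g <= g'.

Definition Pstep_feasible (K : 'M[R]_(m, n)) (g : R) (P : 'M[R]_n) : Prop :=
  0 <= g /\ (forall i : 'I_N, qf P (succ K i) <= g ^+ 2 * qf P (xs i)) /\
  psd (P - 1%:M).
Definition Pstep_solution (K : 'M[R]_(m, n)) (g : R) (P : 'M[R]_n) : Prop :=
  Pstep_feasible K g P /\
  forall g' P', Pstep_feasible K g' P' -> g <= g'.

(* (gout, Pout, Kout) is a possible output of Algorithm 1 with tolerance tol
   (the algorithm terminates after T+1 iterations) *)
Definition alg1_output (tol : R) (gout : R) (Pout : 'M[R]_n)
    (Kout : 'M[R]_(m, n)) : Prop :=
  exists (T : nat) (Ps : nat -> 'M[R]_n) (Ks : nat -> 'M[R]_(m, n))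
         (gs : nat -> R),
    [/\ Ps 0%N = 1%:M /\ Kstep_solution (Ps 0%N) (gs 0%N) (Ks 0%N),
        (forall k, (k <= T)%N ->
           (exists g, Pstep_solution (Ks k) g (Ps k.+1)) /\
           Kstep_solution (Ps k.+1) (gs k.+1) (Ks k.+1)),
        (forall k, (k < T)%N -> tol <= `|gs k.+1 - gs k|),
        `|gs T.+1 - gs T| < tol &
        [/\ gout = gs T.+1, Pout = Ps T.+1 & Kout = Ks T.+1]].
End Algo.

Definition lambda_max n (P : 'M[R]_n) : R := sup [set a | eigenvalue P a].
Definition lambda_min n (P : 'M[R]_n) : R := inf [set a | eigenvalue P a].
Definition kappa n (P : 'M[R]_n) : R := lambda_max P / lambda_min P.

Definition opnorm n (X : 'M[R]_n) : R :=
  sup [set enorm (X *m x) | x in @sphere n].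

Definition jsr n m M (A : 'I_M -> 'M[R]_n) (B : 'M[R]_(n, m))
    (K : 'M[R]_(m, n)) : R :=
  limn (fun k : nat =>
    \big[Order.max/0]_(s : {ffun 'I_k -> 'I_M})
      (opnorm (\prod_(i < k) (A (s (rev_ord i)) + B *m K)) `^ (k%:R^-1))).

End Defs.

(* Main.v *)
(* Let theta = delta^{-1}(eps). A maximal family of points of the sphere at
   pairwise projective angle larger than theta/2 has at most 1/delta(theta/4)
   members, because the caps of angle theta/4 around them are disjoint. The union
   bound shows that, outside an event of probability at most B(eps; N), each of
   the caps of angle theta/2 around these points contains a sample of every mode,
   so that every point of the sphere is within angle theta of a sample of every
   mode.

   In that case let C be a closed-loop mode and let q maximize |C y|_P / |y|_P,
   with maximum L, so that C^T P C q = L^2 P q. For a sample x of this mode within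
   angle theta of q, Cauchy-Schwarz gives
     L^2 |x^T P q| = |(C x)^T P (C q)| <= gamma |x|_P L |q|_P,
   whereas |x - q|^2 <= 2 (1 - cos theta) forces
     |x^T P q| >= (1 - kappa(P) (1 - cos theta)) |x|_P |q|_P.
   Hence all modes contract the norm |.|_P by gamma / (1 - kappa(P) (1 - cos theta)),
   which therefore bounds the joint spectral radius. *)
Require Import Defs.
From HB Require Import structures.
From mathcomp Require Import all_boot all_order all_algebra.
From mathcomp Require Import all_classical all_reals all_analysis.
From mathcomp Require Import measurable_realfun ring lra.
Import Order.TTheory GRing.Theory Num.Theory.
Import numFieldNormedType.Exports.
Local Open Scope classical_set_scope.
Local Open Scope ring_scope.

Set Implicit Arguments.
Unset Strict Implicit.
Unset Printing Implicit Defensive.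

(** * Inner product, quadratic forms and Rayleigh quotients *)

Definition dot {R : realType} {n} (x y : 'cV[R]_n) : R := (x^T *m y) 0 0.

Lemma continuous_mul (R : realType) (T : topologicalType) (f g : T -> R) :
  continuous f -> continuous g -> continuous (fun x => f x * g x).
Proof. by move=> cf cg x; apply: cvgM; [exact: cf|exact: cg]. Qed.

Section Dot.
Variables (R : realType) (n : nat).
Implicit Types (x y z : 'cV[R]_n) (P Q : 'M[R]_n) (a : R).

Lemma dotE x y : dot x y = \sum_i x i 0 * y i 0.
Proof. by rewrite /dot mxE; apply: eq_bigr => i _; rewrite mxE. Qed.

Lemma dotC x y : dot x y = dot y x.
Proof. by rewrite !dotE; apply: eq_bigr => i _; rewrite mulrC. Qed.

Lemma dotDr x y z : dot x (y + z) = dot x y + dot x z.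
Proof. by rewrite /dot mulmxDr mxE. Qed.

Lemma dotDl x y z : dot (x + y) z = dot x z + dot y z.
Proof. by rewrite dotC dotDr !(dotC z). Qed.

Lemma dotZr a x y : dot x (a *: y) = a * dot x y.
Proof. by rewrite /dot -scalemxAr mxE. Qed.

Lemma dotZl a x y : dot (a *: x) y = a * dot x y.
Proof. by rewrite dotC dotZr dotC. Qed.

Lemma dotNr x y : dot x (- y) = - dot x y.
Proof. by rewrite -scaleN1r dotZr mulN1r. Qed.

Lemma dotNl x y : dot (- x) y = - dot x y.
Proof. by rewrite -scaleN1r dotZl mulN1r. Qed.

Lemma dot0r x : dot x 0 = 0.
Proof. by rewrite -(scale0r 0) dotZr mul0r. Qed.

Lemma dot_ge0 x : 0 <= dot x x.
Proof. by rewrite dotE sumr_ge0// => i _; rewrite -expr2 sqr_ge0. Qed.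

Lemma dot_eq0 x : (dot x x == 0) = (x == 0).
Proof.
apply/eqP/eqP => [|->]; last exact: dot0r.
rewrite dotE => x0; apply/colP => i; rewrite mxE.
have sq_ge0 j : true -> 0 <= x j 0 * x j 0 by rewrite -expr2 sqr_ge0.
by have := psumr_eq0P sq_ge0 x0 (i := i) isT; move/eqP; rewrite mulf_eq0 orbb => /eqP.
Qed.

Lemma dot_gt0 x : (0 < dot x x) = (x != 0).
Proof. by rewrite lt0r dot_ge0 andbT dot_eq0. Qed.

Lemma dot_mul P x y : dot x (P *m y) = dot (P^T *m x) y.
Proof. by rewrite /dot trmx_mul trmxK mulmxA. Qed.

Lemma sphereE x : sphere x <-> dot x x = 1.
Proof.
rewrite /sphere/= /enorm -/(dot x x); split=> [h|->]; last exact: sqrtr1.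
by rewrite -[LHS]sqr_sqrtr ?dot_ge0// h expr1n.
Qed.

Lemma qfE P x : qf P x = dot x (P *m x).
Proof. by rewrite /qf /dot mulmxA. Qed.

Lemma sphere_scale x : x != 0 -> exists r s, sphere s /\ x = r *: s.
Proof.
move=> x0; have e0 : enorm x != 0 by rewrite gt_eqF// sqrtr_gt0 -/(dot x x) dot_gt0.
exists (enorm x), ((enorm x)^-1 *: x); split; last first.
  by rewrite scalerA divff// scale1r.
apply/sphereE; rewrite dotZl dotZr mulrA -expr2 exprVn.
by rewrite sqr_sqrtr ?dot_ge0// mulVf// dot_eq0.
Qed.

Lemma e0_sphere : (0 < n)%N -> sphere (e0 R n).
Proof.
move=> n0; apply/sphereE; rewrite dotE (bigD1 (Ordinal n0))//= !mxE/= mulr1.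
rewrite big1 ?addr0// => i; rewrite -val_eqE/= !mxE => /negbTE->.
by rewrite mul0r.
Qed.

Lemma dot_sym P x y : P^T = P -> dot x (P *m y) = dot y (P *m x).
Proof. by move=> Ps; rewrite dot_mul Ps dotC. Qed.

Lemma qfD P x y : P^T = P ->
  dot (x + y) (P *m (x + y)) =
  dot x (P *m x) + 2 * dot x (P *m y) + dot y (P *m y).
Proof.
move=> Ps; rewrite mulmxDr !dotDr !dotDl (dot_sym y x Ps); ring.
Qed.

(* [x] minimizes the quadratic form, hence is a critical point of it. *)
Lemma psd_ker P x : P^T = P -> (forall y, 0 <= dot y (P *m y)) ->
  dot x (P *m x) = 0 -> P *m x = 0.
Proof.
move=> Ps Pp Px; apply/eqP; rewrite -dot_eq0.
set y := P *m x; set a := dot y y; have a0 : 0 <= a := dot_ge0 _.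
set b := dot y (P *m y); have b0 : 0 <= b := Pp _.
have b1 : 0 < b + 1 by rewrite ltr_wpDl.
(* At [x - t P x] with [t = a / (b + 1)] the form equals [- t^2 (b + 2)], which forces [t = 0]. The
   [+ 1] keeps the denominator positive when [b = 0]. *)
have := Pp (x + (- (a / (b + 1))) *: y).
rewrite qfD// Px -scalemxAr !dotZr !dotZl -/b (dot_sym _ _ Ps) -/y -/a.
set t := a / (b + 1); have at_ : a = t * (b + 1) by rewrite /t divfK ?gt_eqF.
have t0 : 0 <= t by rewrite /t divr_ge0 // ltW.
rewrite at_ => h.
have : t ^+ 2 * (b + 2) <= 0 by nra.
rewrite pmulr_lle0; last by lra.
by rewrite exprn_even_le0//= => /eqP ->; rewrite mul0r.
Qed.

Lemma CauchySchwarz P x y : P^T = P -> (forall z, z != 0 -> 0 < dot z (P *m z)) ->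
  dot x (P *m y) ^+ 2 <= dot x (P *m x) * dot y (P *m y).
Proof.
move=> Ps Pp; have [->|y0] := eqVneq y 0.
  by rewrite mulmx0 !dot0r mulr0 expr0n.
have c0 := Pp _ y0.
have Pp' z : 0 <= dot z (P *m z).
  by have [->|/Pp/ltW//] := eqVneq z 0; rewrite mulmx0 dot0r.
(* With [a], [b], [c] as set below, the form at [c x - b y] equals [c (a c - b^2)], and [c > 0] can
   be cancelled. *)
have := Pp' (dot y (P *m y) *: x + (- dot x (P *m y)) *: y).
rewrite qfD// -!scalemxAr !dotZr !dotZl.
set a := dot x (P *m x); set b := dot x (P *m y); set c := dot y (P *m y) in c0 *.
by move=> h; rewrite -subr_ge0 -(pmulr_rge0 _ c0); nra.
Qed.

Lemma dot_continuous (F : 'M[R]_n) : continuous (fun x : 'cV[R]_n => dot x (F *m x)).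
Proof.
rewrite (_ : (fun _ => _) =
  (fun x : 'cV[R]_n => \sum_i x i 0 * \sum_j F i j * x j 0)); last first.
  by apply/funext => x; rewrite dotE; apply: eq_bigr => i _; rewrite mxE.
apply: continuous_big => [|i _]; first exact: add_continuous.
apply: continuous_mul; first exact: coord_continuous.
apply: (@continuous_big R _ +%R) => [|j _]; first exact: add_continuous.
by apply: continuous_mul; [exact: cst_continuous|exact: coord_continuous].
Qed.

Lemma dotl_continuous (u : 'cV[R]_n) : continuous (dot u).
Proof.
rewrite (_ : dot u = (fun x : 'cV[R]_n => \sum_i u i 0 * x i 0)); last first.
  by apply/funext => x; rewrite dotE.
apply: continuous_big => [|i _]; first exact: add_continuous.
by apply: continuous_mul; [exact: cst_continuous|exact: coord_continuous].
Qed.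

Lemma dotE1 x : dot x x = dot x (1%:M *m x).
Proof. by rewrite mul1mx. Qed.

Lemma sphere_closed : closed (@sphere R n).
Proof.
rewrite (_ : @sphere R n = (fun x => dot x (1%:M *m x)) @^-1` [set 1]).
  apply: closed_comp => [x _|]; [exact: dot_continuous|exact: closed_eq].
by apply/seteqP; split=> x; rewrite /preimage/= -dotE1 => /sphereE.
Qed.

Lemma trmx_continuous : continuous (fun x : 'rV[R]_n => x^T).
Proof.
move=> x A [B Bx BA]; exists (fun i j => B j i) => [i j|y By].
  by have := Bx j i; rewrite mxE.
by apply: BA => i j; rewrite mxE; exact: By.
Qed.

Lemma sphere_compact : compact (@sphere R n).
Proof.
(* The sphere lies in the box [[-1, 1]^n]. [rV_compact] concerns row vectors, so the box is taken as
   the image of a row box under transposition. *)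
have box : compact ((fun x : 'rV[R]_n => x^T) @`
    [set v : 'rV[R]_n | forall i, `[(-1 : R), 1]%classic (v ord0 i)]).
  apply: continuous_compact.
    by apply: continuous_subspaceT; exact: trmx_continuous.
  apply: (@rV_compact _ _ (fun=> `[(-1 : R), 1]%classic)) => i.
  exact: segment_compact.
apply: subclosed_compact sphere_closed box _ => x /sphereE x1.
exists x^T; last exact: trmxK.
move=> i /=; rewrite mxE in_itv/= -ler_norml -(@expr_le1 _ 2)// -normrX.
rewrite ger0_norm ?sqr_ge0// -x1 dotE (bigD1 i)//= -expr2 lerDl.
by apply: sumr_ge0 => j _; rewrite -expr2 sqr_ge0.
Qed.

(** By compactness the quotient of the two forms attains its maximum [L] on the sphere, at [q], and
    homogeneity extends the bound to all vectors. Then [L G - F] is positive semidefinite and its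
    form vanishes at [q], so [psd_ker] puts [q] in its kernel. *)
Lemma rayleigh (F G : 'M[R]_n) : (0 < n)%N -> F^T = F -> G^T = G ->
  (forall x, x != 0 -> 0 < dot x (G *m x)) ->
  exists q L, [/\ sphere q, forall x, dot x (F *m x) <= L * dot x (G *m x) &
    F *m q = L *: (G *m q)].
Proof.
move=> n0 Fs Gs Gp.
have sn0 x : sphere x -> x != 0.
  by move=> /sphereE x1; rewrite -dot_eq0 x1 oner_eq0.
pose f x := dot x (F *m x) / dot x (G *m x).
have S0 : @sphere R n !=set0 by exists (e0 R n); exact: e0_sphere.
have [|q qS qmax] := @compact_EVT_max _ R f _ S0 (@sphere_compact).
  apply: continuous_in_subspaceT => x /set_mem/sn0/Gp Gx.
  apply: (@cvgM _ _ (nbhs x)); first exact: dot_continuous.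
  by apply: (@cvgV _ _ (nbhs x)); [rewrite gt_eqF|exact: dot_continuous].
move/set_mem in qS; exists q, (f q).
have Fle x : dot x (F *m x) <= f q * dot x (G *m x).
  have [->|/sphere_scale[r [s [sS ->]]]] := eqVneq x 0.
    by rewrite !mulmx0 !dot0r mulr0.
  rewrite -!scalemxAr !dotZr !dotZl.
  have /qmax := mem_set sS.
  rewrite ler_pdivrMr ?Gp ?sn0// => h.
  rewrite [leRHS](_ : _ = r ^+ 2 * (f q * dot s (G *m s))); last by ring.
  by rewrite mulrA -expr2 ler_wpM2l ?sqr_ge0.
split=> //; apply/eqP; rewrite eq_sym -subr_eq0 scalemxAl -mulmxBl; apply/eqP.
apply: psd_ker.
- by rewrite linearB linearZ/= Fs Gs.
- by move=> y; rewrite mulmxBl dotDr dotNr -scalemxAl dotZr subr_ge0.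
by rewrite mulmxBl dotDr dotNr -scalemxAl dotZr /f divfK ?subrr// gt_eqF ?Gp ?sn0.
Qed.

End Dot.

(** * Extreme eigenvalues and contraction of the norm given by [P] *)

Section Contraction.
Variables (R : realType) (n : nat).
Hypothesis n0 : (0 < n)%N.
Implicit Types (x y z q : 'cV[R]_n) (P C : 'M[R]_n).

(** [eigenvalue] is defined through row eigenvectors; symmetry of [P] turns them into columns. *)
Lemma eigen_dot P a : P^T = P -> eigenvalue P a ->
  exists2 x, x != 0 & dot x (P *m x) = a * dot x x.
Proof.
move=> Ps /eigenvalueP[v vP v0]; exists v^T.
  by apply: contra_neq v0 => /(congr1 trmx); rewrite trmxK trmx0.
by rewrite dot_mul Ps -{1}Ps -trmx_mul vP linearZ/= dotZl.
Qed.

Lemma eigenvalue_col P a x : P^T = P -> x != 0 -> P *m x = a *: x ->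
  eigenvalue P a.
Proof.
move=> Ps x0 Px; apply/eigenvalueP; exists x^T.
  by rewrite -{1}Ps -trmx_mul Px linearZ.
by apply: contra_neq x0 => /(congr1 trmx); rewrite trmxK trmx0.
Qed.

Lemma sphere_neq0 x : sphere x -> x != 0.
Proof. by move=> /sphereE x1; rewrite -dot_eq0 x1 oner_eq0. Qed.

Lemma rayleigh1 P : P^T = P -> exists q L,
  [/\ q != 0, forall x, dot x (P *m x) <= L * dot x x & P *m q = L *: q].
Proof.
move=> Ps; have [|x x0|q [L [qS FL Fq]]] := @rayleigh R n P 1%:M n0 Ps.
- exact: trmx1.
- by rewrite mul1mx dot_gt0.
exists q, L; split=> [|x|]; first exact: sphere_neq0.
  by have := FL x; rewrite mul1mx.
by rewrite Fq mul1mx.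
Qed.

(** The maximal Rayleigh quotient is itself an eigenvalue and bounds all the others, so the supremum
    defining [lambda_max] is at least as large. *)
Lemma lambda_max_ge P x : P^T = P -> dot x (P *m x) <= lambda_max P * dot x x.
Proof.
move=> Ps; have [q [L [q0 FL Fq]]] := rayleigh1 Ps.
apply: (le_trans (FL x)); rewrite ler_wpM2r ?dot_ge0//.
apply: ub_le_sup; last exact: eigenvalue_col Fq.
exists L => a /(eigen_dot Ps)[y y0 yE].
by have := FL y; rewrite yE ler_pM2r ?dot_gt0.
Qed.

Lemma lambda_min_le P x : P^T = P -> lambda_min P * dot x x <= dot x (P *m x).
Proof.
(* The minimum of the Rayleigh quotient of [P] is minus the maximum for [- P]. *)
move=> Ps; have NPs : (- P)^T = - P by rewrite linearN/= Ps.
have [q [L [q0 FL Fq]]] := rayleigh1 NPs.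
have FL' y : - L * dot y y <= dot y (P *m y).
  by have := FL y; rewrite mulNmx dotNr mulNr lerNl.
apply: le_trans (FL' x); rewrite ler_wpM2r ?dot_ge0//.
apply: ge_inf.
  exists (- L) => a /(eigen_dot Ps)[y y0 yE].
  by have := FL' y; rewrite yE ler_pM2r ?dot_gt0.
apply: eigenvalue_col q0 _ => //.
by rewrite scaleNr -Fq mulNmx opprK.
Qed.

Lemma lambda_min_ge1 P : P^T = P -> (forall x, dot x x <= dot x (P *m x)) ->
  1 <= lambda_min P.
Proof.
move=> Ps P1; apply: lb_le_inf.
  have NPs : (- P)^T = - P by rewrite linearN/= Ps.
  have [q [L [q0 _ Fq]]] := rayleigh1 NPs; exists (- L).
  apply: eigenvalue_col q0 _ => //; by rewrite scaleNr -Fq mulNmx opprK.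
move=> a /(eigen_dot Ps)[y y0 yE].
by have := P1 y; rewrite yE -{1}(mul1r (dot y y)) ler_pM2r ?dot_gt0.
Qed.

(** After a sign change of [x] making [x^T q >= 0], expanding [|x - q|_P^2] gives [2 x^T P q >=
    |x|_P^2 + |q|_P^2 - lambda_max |x - q|^2]. It remains to use [|x - q|^2 <= 2 (1 - c)] and
    [lambda_max = kappa lambda_min <= kappa |x|_P |q|_P]. *)
Lemma cap_dot P (c : R) x q : P^T = P -> (forall x, dot x x <= dot x (P *m x)) ->
  sphere x -> sphere q -> c <= `|dot x q| ->
  0 < 1 - kappa P * (1 - c) ->
  (1 - kappa P * (1 - c)) ^+ 2 * (dot x (P *m x) * dot q (P *m q))
    <= dot x (P *m q) ^+ 2.
Proof.
move=> Ps P1 + qS; wlog : x / 0 <= dot x q => [hw xS cx D0|xq0 xS].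
  have [xq|/ltW xq] := leP 0 (dot x q); first exact: hw.
  have := hw (- x); rewrite mulmxN !dotNr !dotNl opprK sqrrN normrN oppr_ge0.
  by apply=> //; apply/sphereE; rewrite dotNr dotNl opprK; apply/sphereE.
rewrite (ger0_norm xq0) => cx D0.
have l1 := lambda_min_ge1 Ps P1.
have lmin y : sphere y -> lambda_min P <= dot y (P *m y).
  by move=> /sphereE y1; have := lambda_min_le y Ps; rewrite y1 mulr1.
have hd : dot (x - q) (x - q) <= 2 * (1 - c).
  move/sphereE: (xS) => x1; move/sphereE: (qS) => q1.
  by rewrite dotDl !dotDr !dotNl !dotNr x1 q1 (dotC q x); lra.
have L0 : 0 <= lambda_max P.
  have := lambda_max_ge x Ps; move/sphereE: (xS) => ->; rewrite mulr1.
  by apply: le_trans; apply: le_trans (lmin _ xS); lra.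
have := lambda_max_ge (x - q) Ps.
rewrite qfD// mulmxN !dotNr !dotNl opprK.
have := lmin _ xS; have := lmin _ qS.
set a := dot x (P *m x); set b := dot q (P *m q); set e := dot x (P *m q).
move=> bm am h.
have kE : lambda_max P = kappa P * lambda_min P.
  by rewrite /kappa divfK// gt_eqF//; lra.
have k0 : 0 <= kappa P by rewrite /kappa divr_ge0//; lra.
have aE : Num.sqrt a ^+ 2 = a by rewrite sqr_sqrtr//; lra.
have bE : Num.sqrt b ^+ 2 = b by rewrite sqr_sqrtr//; lra.
have u0 := sqrtr_ge0 a; have v0 := sqrtr_ge0 b.
set u := Num.sqrt a in aE u0; set v := Num.sqrt b in bE v0.
have uv : lambda_min P <= u * v.
  rewrite -(ler_pXn2r (n := 2))// ?nnegrE ?mulr_ge0//; last by lra.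
  by rewrite exprMn aE bE expr2; apply: ler_pM => //; lra.
have eD : (1 - kappa P * (1 - c)) * (u * v) <= e.
  have h1 : lambda_max P * dot (x - q) (x - q) <= lambda_max P * (2 * (1 - c)).
    exact: ler_wpM2l.
  have c1 : 0 <= 1 - c by have := dot_ge0 (x - q); lra.
  have h2 : lambda_max P * (1 - c) <= kappa P * (u * v) * (1 - c).
    by rewrite kE ler_wpM2r// ler_wpM2l.
  have h3 : 0 <= (u - v) ^+ 2 := sqr_ge0 _.
  by nra.
rewrite -aE -bE -exprMn -exprMn ler_pXn2r// nnegrE; last apply: le_trans eD.
  by rewrite !mulr_ge0// ltW.
by rewrite !mulr_ge0// ltW.
Qed.

(** The cover is applied at one point, the maximizer [q] of the ratio of the forms of [C^T P C] and
    [P]; bounding the maximum [L] bounds the ratio everywhere. *)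
Lemma cover_contraction P C (c g : R) :
  P^T = P -> (forall x, dot x x <= dot x (P *m x)) ->
  (forall z, sphere z -> exists x, [/\ sphere x, c <= `|dot x z| &
     qf P (C *m x) <= g ^+ 2 * qf P x]) ->
  0 < 1 - kappa P * (1 - c) ->
  forall y, qf P (C *m y) <= (g / (1 - kappa P * (1 - c))) ^+ 2 * qf P y.
Proof.
move=> Ps P1 cover D0 y; set D := 1 - _ in D0 *.
have Pp x : x != 0 -> 0 < dot x (P *m x).
  by rewrite -dot_gt0 => /lt_le_trans; apply.
have Pp' x : 0 <= dot x (P *m x) by apply: le_trans (P1 x); exact: dot_ge0.
have CC x z : dot x (C^T *m P *m C *m z) = dot (C *m x) (P *m (C *m z)).
  by rewrite -!mulmxA dot_mul trmxK.
have CPC : (C^T *m P *m C)^T = C^T *m P *m C by rewrite !trmx_mul trmxK Ps mulmxA.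
have [q [L [qS FL Fq]]] := rayleigh n0 CPC Ps Pp.
have [x [xS cx Cx]] := cover q qS.
have xp := Pp _ (sphere_neq0 xS); have qp := Pp _ (sphere_neq0 qS).
suff LD : L * D ^+ 2 <= g ^+ 2.
  rewrite !qfE; have := FL y; rewrite CC => /le_trans; apply.
  rewrite ler_wpM2r// expr_div_n ler_pdivlMr// exprn_gt0//.
have [L0|L0] := leP L 0.
  by apply: (@le_trans _ _ 0); rewrite ?sqr_ge0// mulr_le0_ge0// sqr_ge0.
have h1 : L * dot x (P *m q) = dot (C *m x) (P *m (C *m q)).
  by rewrite -CC Fq dotZr.
have h2 : dot (C *m q) (P *m (C *m q)) = L * dot q (P *m q).
  by rewrite -CC Fq dotZr.
have := CauchySchwarz (C *m x) (C *m q) Ps Pp.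
rewrite -h1 h2 => cs; have := cap_dot Ps P1 xS qS cx D0; rewrite -/D => cd.
rewrite !qfE in Cx; move: cs cd Cx; rewrite exprMn.
set e := dot x (P *m q) ^+ 2; set b := dot q _ in qp *; set a := dot x _ in xp *.
set d := dot (C *m x) _ => cs cd Cx.
(* The chain is [L^2 D^2 a b <= L^2 e <= d L b <= g^2 a L b], from which the positive factor [L a b]
   is cancelled. *)
have ab : 0 < L * (a * b) by rewrite !mulr_gt0.
rewrite -(ler_pM2r ab).
have s1 : L ^+ 2 * (D ^+ 2 * (a * b)) <= L ^+ 2 * e by rewrite ler_wpM2l ?sqr_ge0.
have s2 : d * (L * b) <= g ^+ 2 * a * (L * b) by rewrite ler_wpM2r// ltW// mulr_gt0.
by nra.
Qed.

End Contraction.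

(** * From a common contraction to the joint spectral radius *)

Section JointSpectralRadius.
Variables (R : realType) (n : nat).
Hypothesis n0 : (0 < n)%N.

Lemma qf_prod (P : 'M[R]_n) (c : R) k (F : 'I_k -> 'M[R]_n) :
  (forall i y, qf P (F i *m y) <= c ^+ 2 * qf P y) ->
  forall y, qf P ((\prod_(i < k) F i) *m y) <= (c ^+ k) ^+ 2 * qf P y.
Proof.
elim: k F => [|k IH] F hF y.
  by rewrite big_ord0 mul1mx expr0 expr1n mul1r.
rewrite big_ord_recl -mulmxA; apply: le_trans (hF _ _) _.
rewrite (exprS c k) exprMn -[leRHS]mulrA ler_wpM2l ?sqr_ge0//.
by apply: IH => i z; exact: hF.
Qed.

Lemma opnorm_le (Y : 'M[R]_n) (b : R) :
  (forall x, sphere x -> enorm (Y *m x) <= b) -> 0 <= opnorm Y <= b.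
Proof.
move=> hY; have e1 := e0_sphere R n0.
have ub : has_ubound [set enorm (Y *m x) | x in @sphere R n].
  by exists b => _ [x xS <-]; exact: hY.
apply/andP; split; last first.
  by apply: ge_sup => [|_ [x xS <-]]; [exists (enorm (Y *m e0 R n)), (e0 R n)|exact: hY].
apply: (@le_trans _ _ (enorm (Y *m e0 R n))); first exact: sqrtr_ge0.
by apply: ub_le_sup => //; exists (e0 R n).
Qed.

Lemma powR_harmonic_cvg1 (l : R) : 0 < l -> l `^ (k.+1%:R^-1) @[k --> \oo] --> (1 : R).
Proof.
move=> l0; rewrite (_ : (fun k => _) = (fun k : nat => expR (harmonic k * ln l))); last first.
  by apply/funext => k; rewrite /powR gt_eqF.
rewrite -expR0 -(mul0r (ln l)).
apply: continuous_cvg; first exact: continuous_expR.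
by apply: cvgMl; exact: cvg_harmonic.
Qed.

(** Since [|x| <= |x|_P <= l |x|] with [l] the square root of [lambda_max P], a product of [k] modes
    has operator norm at most [c^k l], and the [k]-th root of [l] tends to 1. *)
Lemma jsr_le m M (A : 'I_M -> 'M[R]_n) (B : 'M[R]_(n, m)) K (P : 'M[R]_n) (c : R) :
  P^T = P -> (forall x, dot x x <= dot x (P *m x)) -> 0 <= c ->
  (forall s y, qf P ((A s + B *m K) *m y) <= c ^+ 2 * qf P y) ->
  jsr A B K <= c.
Proof.
move=> Ps P1 c0 hA; rewrite /jsr; set u := (fun k : nat => _).
pose l := Num.sqrt (lambda_max P).
have lmax1 : 1 <= lambda_max P.
  have /sphereE e1 := e0_sphere R n0.
  have := lambda_max_ge n0 (e0 R n) Ps; rewrite e1 mulr1.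
  by apply: le_trans; rewrite -e1.
have l0 : 0 < l by rewrite sqrtr_gt0 (lt_le_trans _ lmax1).
have ule k : u k.+1 <= c * l `^ (k.+1%:R^-1).
  apply: bigmax_le => [|s _]; first by rewrite mulr_ge0// powR_ge0.
  set Y := \prod_(i < _) _.
  have /andP[op0 ople] : 0 <= opnorm Y <= c ^+ k.+1 * l.
    apply: opnorm_le => x /sphereE x1.
    rewrite -(@ler_pXn2r _ 2) ?nnegrE ?sqrtr_ge0 ?mulr_ge0 ?exprn_ge0 ?(ltW l0)//.
    rewrite /enorm -/(dot _ _) sqr_sqrtr ?dot_ge0// exprMn sqr_sqrtr; last lra.
    apply: (le_trans (P1 _)); rewrite -qfE.
    apply: (le_trans (qf_prod _ _)) => [i y|]; first exact: hA.
    rewrite ler_wpM2l ?sqr_ge0// qfE -[leRHS]mulr1 -x1.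
    exact: lambda_max_ge.
  rewrite {1}(_ : c = (c ^+ k.+1) `^ (k.+1%:R^-1)).
    rewrite -powRM ?exprn_ge0//; last exact: ltW.
    by apply: ge0_ler_powR => //; rewrite nnegrE// mulr_ge0 ?exprn_ge0// ltW.
  by rewrite -powR_mulrn// -powRrM divff ?powRr1.
(* [limn] of a divergent sequence is the junk value 0. *)
have [cu|ncu] := pselect (cvgn u); last first.
  rewrite /lim /lim_in xgetPN// => x ux; exact/ncu/cvgP/ux.
(* The shift discards the term [k = 0], whose exponent is the junk value [0^-1 = 0]. *)
have h1 : (fun k => u k.+1) @ \oo --> limn u by rewrite cvg_shiftS.
have h2 : c * l `^ (k.+1%:R^-1) @[k --> \oo] --> c.
  by rewrite -[X in _ --> X]mulr1; apply: cvgMr; exact: powR_harmonic_cvg1.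
by apply: ler_cvg_to h1 h2 _; near=> k; exact: ule.
Unshelve. all: by end_near.
Qed.

End JointSpectralRadius.

(** The deterministic half of the theorem. In the last iteration the P-step makes [P - I] positive
    semidefinite, and the K-step for this same [P] gives the contraction inequality at every
    sample. *)
Lemma alg1_jsr_le (R : realType) (n m M N : nat) (A : 'I_M -> 'M[R]_n)
    (B : 'M[R]_(n, m)) (xs : 'I_N -> 'cV[R]_n) (ss : 'I_N -> 'I_M)
    (tol g c : R) (P : 'M[R]_n) (K : 'M[R]_(m, n)) : (0 < n)%N ->
  (forall s z, sphere z -> exists i,
     [/\ ss i = s, sphere (xs i) & c <= `|dot (xs i) z|]) ->
  alg1_output A B xs ss tol g P K -> kappa P * (1 - c) < 1 ->
  jsr A B K <= g / (1 - kappa P * (1 - c)).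
Proof.
move=> n0 cover [T [Ps [Ks [gs [_ /(_ _ (leqnn T))[[g' [[_ [_ [PPs PPge]]] _]]]]]]]].
move=> [[g0 feas] _] _ _ [-> -> ->] {g P K}; set P := Ps _ in PPs PPge feas *.
rewrite -subr_gt0 => D0.
have Psym : P^T = P.
  by move: PPs; rewrite linearB/= trmx1 => /(congr1 (+%R^~ 1%:M)); rewrite !subrK.
have P1 x : dot x x <= dot x (P *m x).
  have := PPge x; rewrite -mulmxA -/(dot x _) mulmxBl mul1mx dotDr dotNr.
  by rewrite subr_ge0.
have step i : qf P ((A (ss i) + B *m Ks T.+1) *m xs i) <= gs T.+1 ^+ 2 * qf P (xs i).
  (* One direction of the Schur complement: testing the block matrix on [(1, - y)], with [y] the
     closed-loop successor, leaves [g^2 x^T P x - y^T P y]. *)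
  have [_ /(_ (col_mx 1%:M (- succ A B xs ss (Ks T.+1) i)))] := feas i.
  set y := succ _ _ _ _ _ _; rewrite mulmxDl -/y.
  rewrite tr_col_mx mul_row_block mul_row_col trmx1 !mul1mx linearN/= !mulNmx.
  rewrite !mulmxA !mulmxN !mulmx1 subrr mul0mx oppr0 addr0 mxE.
  by rewrite [X in X + _]mxE [X in _ + X]mxE mulr1n subr_ge0.
apply: (@jsr_le _ _ n0 m M A B (Ks T.+1) P) => //.
  by rewrite divr_ge0// ltW.
move=> s y; apply: cover_contraction => // z /(cover s)[i [<- xS cx]].
by exists (xs i).
Qed.

(** * Projective angles and reflections *)

Section Caps.
Variables (R : realType) (n : nat).
Implicit Types (x y z u v : 'cV[R]_n).

(** A triangle inequality for projective angles, written in cosines: if [k] is the cosine of an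
    angle, [2 k^2 - 1] is the cosine of its double. *)
Lemma cap_trans (k : R) x y v : 0 <= k -> sphere x -> sphere y -> sphere v ->
  k <= `|dot x v| -> k <= `|dot y v| -> 2 * k ^+ 2 - 1 <= `|dot x y|.
Proof.
move=> k0 + + /sphereE v1.
wlog : x / 0 <= dot x v => [hw xS yS kx ky|x0].
  have [xv|/ltW xv] := leP 0 (dot x v); first exact: (hw x).
  have := hw (- x); rewrite !dotNl !normrN oppr_ge0; apply=> //.
  by apply/sphereE; rewrite dotNr dotNl opprK; apply/sphereE.
wlog : y / 0 <= dot y v => [hw xS yS kx ky|y0].
  have [yv|/ltW yv] := leP 0 (dot y v); first exact: (hw y).
  have := hw (- y); rewrite dotNr !dotNl !normrN oppr_ge0; apply=> //.
  by apply/sphereE; rewrite dotNr dotNl opprK; apply/sphereE.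
move=> /sphereE x1 /sphereE y1; rewrite (ger0_norm x0) (ger0_norm y0) => kx ky.
apply: le_trans (ler_norm _).
(* the components of [x] and [y] orthogonal to [v] have norm at most sqrt(1 - k^2) *)
have := dot_ge0 (x + y - (dot x v + dot y v) *: v).
rewrite !(dotDl, dotDr, dotNl, dotNr, dotZl, dotZr) x1 y1 v1 (dotC y x) !(dotC v).
set a := dot x v in kx *; set b := dot y v in ky *; set e := dot x y => h.
have : k * k <= a * b by apply: ler_pM.
have : k * k <= a * a by apply: ler_pM.
have : k * k <= b * b by apply: ler_pM.
by nra.
Qed.

(** The reflection in the hyperplane orthogonal to [u - v] exchanges [u] and [v]; if [u = v] the
    identity is taken. *)
Lemma householder u v : sphere u -> sphere v ->
  exists2 Q : 'M[R]_n, orthogonal_mx Q & Q^T *m v = u.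
Proof.
move=> /sphereE u1 /sphereE v1; pose w := u - v; pose d := dot w w.
have wv : dot w v = - (d / 2).
  by rewrite /d /w !(dotDl, dotDr, dotNl, dotNr) u1 v1 (dotC v u); lra.
have mulw x : (w *m w^T) *m x = dot w x *: w.
  by apply/colP => i; rewrite -mulmxA mxE big_ord1 [RHS]mxE mulrC.
pose Q := 1%:M - (2 / d) *: (w *m w^T).
have Qs : Q^T = Q by rewrite linearB/= trmx1 linearZ/= trmx_mul trmxK.
have ww : (w *m w^T) *m (w *m w^T) = d *: (w *m w^T).
  by rewrite mulmxA -(mulmxA w) [w^T *m w]mx11_scalar mul_mx_scalar -scalemxAl.
have [w0|w0] := eqVneq w 0.
  exists 1%:M; first by rewrite /orthogonal_mx trmx1 mul1mx.
  by rewrite trmx1 mul1mx; apply/esym/eqP; rewrite -subr_eq0 -/w w0.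
have d0 : d != 0 by rewrite dot_eq0.
exists Q.
  rewrite /orthogonal_mx Qs mulmxBl mul1mx mulmxBr mulmx1 -scalemxAl -scalemxAr ww.
  rewrite !scalerA (_ : 2 / d * (2 / d) * d = 2 / d + 2 / d); last by field.
  by rewrite scalerDl opprD opprK addKr subrK.
rewrite Qs mulmxBl mul1mx -scalemxAl mulw wv scalerA.
rewrite (_ : 2 / d * _ = - 1); last by field.
by rewrite scaleN1r opprK addrC subrK.
Qed.

End Caps.

(** * Union bounds and a bound for families of limited overlap *)

Section Measure.
Variables (R : realType) (d : measure_display) (T : measurableType d).
Variable mu : probability T R.
Local Open Scope ereal_scope.

Lemma measure_bigsetU_le (I : Type) (r : seq I) (F : I -> set T) :
  (forall i, measurable (F i)) ->
  mu (\big[setU/set0]_(i <- r) F i) <= \sum_(i <- r) mu (F i).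
Proof.
move=> mF; elim: r => [|i r IH]; first by rewrite !big_nil measure0.
rewrite !big_cons; apply: le_trans (measureU2 _ _ _) _ => //.
  exact: bigsetU_measurable.
exact: leeD2l.
Qed.

Lemma measure_seq_le (I : choiceType) (r : seq I) (F : I -> set T) (A : set T) :
  (forall i, measurable (F i)) -> measurable A ->
  A `<=` \bigcup_(i in [set` r]) F i -> mu A <= \sum_(i <- r) mu (F i).
Proof.
move=> mF mA AF; apply: le_trans (measure_bigsetU_le _ mF).
by apply: le_measure; rewrite ?inE -?bigcup_seq//; exact: fin_bigcup_measurable.
Qed.

Lemma measure_finType_le (I : finType) (F : I -> set T) (A : set T) :
  (forall i, measurable (F i)) -> measurable A -> A `<=` \bigcup_i F i ->
  mu A <= \sum_i mu (F i).
Proof.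
move=> mF mA AF; apply: measure_seq_le => //.
by apply: subset_trans AF _ => x [i _ Fx]; exists i => //=; exact: mem_index_enum.
Qed.

(** The sum is the integral of the function counting the sets that contain a point, and this
    function is at most [L]. *)
Lemma sum_measure_overlap k (F : 'I_k -> set T) (L : nat) :
  (forall i, measurable (F i)) ->
  (forall x, (#|[pred i | x \in F i]| <= L)%N) ->
  \sum_(i < k) mu (F i) <= L%:R%:E.
Proof.
move=> mF ov.
rewrite (eq_bigr (fun i => \int[mu]_x (\1_(F i) x)%:E)); last first.
  by move=> i _; rewrite integral_indic ?setIT.
rewrite -ge0_integral_sum//; last first.
  by move=> i; exact/measurable_EFinP/measurable_indic.
apply: (@le_trans _ _ (\int[mu]_x (cst L%:R%:E x))); last first.
  by rewrite integral_cst// -[leRHS]mule1 -(probability_setT mu).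
apply: ge0_le_integral => //.
- by move=> x _; rewrite sume_ge0.
- by apply: emeasurable_sum => i; exact/measurable_EFinP/measurable_indic.
move=> x _; rewrite sumEFin lee_fin.
rewrite (eq_bigr (fun i => ((x \in F i) : nat)%:R)%R); last by move=> i _; rewrite indicE.
rewrite -natr_sum ler_nat; apply: leq_trans (ov x); rewrite -sum1_card [leqRHS]big_mkcond.
by apply: leq_sum => i _; rewrite inE; case: (x \in _).
Qed.

End Measure.

(** One form for both the caps ([D = capm c]) and their boundary sections, where the absolute value
    of the inner product is fixed. *)
Definition band {R : realType} {n} (u : 'cV[R]_n) (D : set R) : set (Rn R n) :=
  [set v : 'cV[R]_n | sphere v /\ D (dot u v)].

(** * Caps under the rotation-invariant measure *)

Section UniformMeasure.
Variables (R : realType) (n : nat) (mu : probability (Rn R n) R).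
Hypothesis n0 : (0 < n)%N.
Hypothesis mu_unif : uniform_on_sphere mu.
Implicit Types (u v z : 'cV[R]_n) (D : set R).

Lemma closed_measurable (A : set 'cV[R]_n) : closed A -> measurable (A : set (Rn R n)).
Proof.
rewrite -openC -[X in measurable (X : set (Rn R n))]setCK => oA.
by apply: measurableC; exact: sub_sigma_algebra.
Qed.

Lemma measurable_band u D : closed D -> measurable (band u D).
Proof.
move=> cD; apply: closed_measurable; apply: closedI; first exact: sphere_closed.
by apply: closed_comp => // v _; exact: dotl_continuous.
Qed.

Lemma measurable_sphere : measurable (@sphere R n : set (Rn R n)).
Proof. by apply: closed_measurable; exact: sphere_closed. Qed.

Lemma mu_sphere : mu (@sphere R n : set (Rn R n)) = 1%E.
Proof.
have := probability_setC mu (measurableC measurable_sphere).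
by rewrite setCK mu_unif.1 sube0.
Qed.

(** A reflection [Q] with [Q^T e0 = u] pulls the band around [e0] back to the band around [u]. *)
Lemma mu_band u D : sphere u -> closed D -> mu (band u D) = mu (band (e0 R n) D).
Proof.
move=> uS cD; have [Q Qo Qu] := householder uS (e0_sphere R n0).
rewrite -(mu_unif.2 Q Qo _ (measurable_band (e0 R n) cD)); congr (mu _).
apply/seteqP; split=> v; rewrite /band/preimage/= dot_mul Qu.
  by move=> [/sphereE vS Dv]; split=> //; apply/sphereE; rewrite dot_mul mulmxA Qo mul1mx.
by move=> [/sphereE vS Dv]; split=> //; apply/sphereE; move: vS; rewrite dot_mul mulmxA Qo mul1mx.
Qed.

Definition capm (c : R) : set R := [set t | c <= `|t|].

Lemma closed_capm c : closed (capm c).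
Proof.
by apply: (@closed_comp _ _ (@Num.norm _ R) [set t | c <= t]) => [t _|];
  [exact: norm_continuous|exact: closed_ge].
Qed.

Definition capmeas c : R := fine (mu (band (e0 R n) (capm c))).

Lemma mu_capE u c : sphere u -> mu (band u (capm c)) = (capmeas c)%:E.
Proof.
move=> uS; rewrite (mu_band uS (@closed_capm c)) fineK//.
by apply: fin_num_measure; apply: measurable_band; exact: closed_capm.
Qed.

Lemma deltaE theta : delta mu theta = capmeas (cos theta).
Proof. by []. Qed.

Lemma capmeas_ge0 c : 0 <= capmeas c.
Proof. exact: fine_ge0. Qed.

Lemma dot_le1 u v : sphere u -> sphere v -> `|dot u v| <= 1.
Proof.
move=> /sphereE u1 /sphereE v1; rewrite ler_norml.
have := dot_ge0 (u + v); have := dot_ge0 (u - v).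
by rewrite !(dotDl, dotDr, dotNl, dotNr) u1 v1 (dotC v u); lra.
Qed.

(** By compactness finitely many caps cover the sphere; by rotation invariance all have the same
    measure, so null caps would contradict total mass 1. *)
Lemma capmeas_gt0 c : c < 1 -> 0 < capmeas c.
Proof.
move=> c1; rewrite lt_neqAle capmeas_ge0 andbT; apply/eqP => f0.
pose f z := [set v | c < `|dot z v|].
have fo z : @sphere R n z -> open (f z).
  move=> _; apply: (@open_comp _ _ (fun v => `|dot z v|) [set t | c < t]) => [v _|].
    by apply: continuous_comp; [exact: dotl_continuous|exact: norm_continuous].
  exact: open_gt.
have := @sphere_compact R n; rewrite compact_cover => /(_ _ (@sphere R n) f fo)[].
  by move=> z zS; exists z => //=; rewrite /f/= (sphereE z).1// normr1.
move=> D DS Dcov.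
have : (mu (@sphere R n : set (Rn R n)) <=
    \sum_(z <- finmap.enum_fset D) mu (band z (capm c)))%E.
  apply: measure_seq_le.
  - by move=> z; apply: measurable_band; exact: closed_capm.
  - exact: measurable_sphere.
  by move=> v vS; have [z /= zD zv] := Dcov v vS; exists z => //; split=> //; exact: ltW.
rewrite mu_sphere big_seq big1 ?lee_fin ?ler10// => z zD.
by rewrite mu_capE -?f0//; apply/set_mem/DS.
Qed.

End UniformMeasure.

(** * Boundary sections of caps are null *)

Section NullSections.
Variables (R : realType) (n : nat) (mu : probability (Rn R n) R).
Hypothesis n0 : (0 < n)%N.
Hypothesis mu_unif : uniform_on_sphere mu.
Implicit Types (u v z : 'cV[R]_n).

Let circle (c : R) : set R := [set t | `|t| = c].

Lemma closed_circle c : closed (circle c).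
Proof.
by apply: (@closed_comp _ _ (@Num.norm _ R) [set t | t = c]) => [t _|];
  [exact: norm_continuous|exact: closed_eq].
Qed.

(* Infinitely many rotated copies of the section have the same measure; if each
   point of the sphere lies in at most [L] of them, this measure vanishes. *)
Lemma mu_section0 (c : R) (w : nat -> 'cV[R]_n) (L : nat) :
  (forall i, w i != 0) ->
  (forall v, sphere v -> exists q : {poly R}, [/\ q != 0, (size q <= L)%N &
     forall i, dot (w i) v ^+ 2 = c ^+ 2 * dot (w i) (w i) -> root q i%:R]) ->
  mu (band (e0 R n) (circle c)) = 0%E.
Proof.
move=> w0 hq.
have /choice[u hu] i : exists u, sphere u /\ exists r, w i = r *: u.
  by have [r [u [uS wE]]] := sphere_scale (w0 i); exists u; split=> //; exists r.
have pfin : mu (band (e0 R n) (circle c)) \is a fin_num.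
  by apply: fin_num_measure; apply: measurable_band; exact: closed_circle.
rewrite -(fineK pfin); set p := fine _; congr (_%:E).
have p0 : 0 <= p by exact: fine_ge0.
have kp k : k%:R * p <= L%:R.
  have := @sum_measure_overlap R _ _ mu k (fun i => band (u i) (circle c)) L.
  rewrite (eq_bigr (fun=> p%:E)); last first.
    move=> i _; have [uS _] := hu i.
    by rewrite (mu_band n0 mu_unif uS (@closed_circle c)) fineK.
  rewrite sumEFin lee_fin sumr_const card_ord mulr_natl; apply.
    by move=> i; apply: measurable_band; exact: closed_circle.
  move=> v; have [vS|vS] := pselect (sphere v); last first.
    rewrite eq_card0// => i; rewrite !inE; apply/negbTE/negP => /set_mem; case.
    by move=> /vS.
  have [q [q0 qL qr]] := hq v vS; set pr := [pred i | _].
  (* The indices of the copies through [v] are distinct roots of [q], hence fewer than its size. *)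
  have -> : #|pr| = size [seq ((val i)%:R : R) | i <- enum pr] by rewrite size_map -cardE.
  apply: leq_trans qL; apply/ltnW/max_poly_roots => //.
    apply/allP => _ /mapP[i + ->]; rewrite mem_enum !inE => -[_ vc].
    have [uS [r wE]] := hu i; apply: qr; rewrite wE.
    move: vc; rewrite /circle/= => vc.
    rewrite !dotZl dotZr (sphereE _).1// exprMn -vc real_normK ?num_real//; ring.
  rewrite map_inj_uniq ?enum_uniq// => i j /eqP.
  by rewrite eqr_nat => /eqP/val_inj.
(* A positive [p] would violate [k p <= L] for large [k], by the Archimedean property. *)
apply/eqP; rewrite eq_le p0 andbT leNgt; apply/negP => pp.
have := archi_boundP (divr_ge0 (ler0n R L) p0).
by rewrite ltr_pdivrMr// ltNge kp.
Qed.

Lemma dot_delta i v : dot (delta_mx i 0) v = v i 0.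
Proof.
rewrite dotE (bigD1 i)//= !mxE !eqxx mul1r big1 ?addr0// => j /negbTE ji.
by rewrite mxE ji mul0r.
Qed.

(** This yields continuity of the cap measure in [c]. In dimension 1 it fails at [c = 1], where the
    section is the whole sphere. *)
Lemma mu_circle0 (c : R) : (1 < n)%N -> 0 <= c ->
  mu (band (e0 R n) (circle c)) = 0%E.
Proof.
move=> n1; rewrite le_eqVlt => /predU1P[<-|c0].
  (* A nonzero v is orthogonal to at most n - 1 points (1, t, .., t^(n-1)). *)
  apply: (@mu_section0 0 (fun i => \col_(j < n) (i%:R ^+ j)) n) => [i|v vS].
    apply/eqP => /matrixP/(_ (Ordinal n0) 0); rewrite !mxE expr0 => /eqP.
    by rewrite oner_eq0.
  exists (rVpoly v^T); split=> [||i].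
  - apply: contra_neq (sphere_neq0 vS) => /(congr1 (@poly_rV _ n)).
    by rewrite rVpolyK linear0 => /(congr1 trmx); rewrite trmxK trmx0.
  - exact: size_poly.
  move=> h; have : dot (\col_(j < n) (i%:R ^+ j)) v == 0.
    by rewrite -sqrf_eq0 h expr0n mul0r.
  rewrite /root horner_poly dotE => /eqP w0; apply/eqP; rewrite -[RHS]w0; apply: eq_bigr => j _.
  by rewrite valK !mxE mulrC.
(* For c > 0, (v0 + t v1)^2 = c^2 (1 + t^2) is a nontrivial quadratic equation in t. *)
pose i0 := Ordinal n0; pose i1 := Ordinal n1.
pose w (i : nat) : 'cV[R]_n := delta_mx i0 0 + i%:R *: delta_mx i1 0.
have wv i v : dot (w i) v = v i0 0 + i%:R * v i1 0.
  by rewrite dotDl dotZl !dot_delta.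
have ww i : dot (w i) (w i) = 1 + i%:R ^+ 2.
  by rewrite wv !mxE !eqxx /= !mulr1 mulr0 addr0 add0r expr2.
apply: (@mu_section0 c w 3) => [i|v vS].
  by rewrite -dot_gt0 ww; have := sqr_ge0 (i%:R : R); lra.
pose a := v i0 0; pose b := v i1 0.
exists (Poly [:: a ^+ 2 - c ^+ 2; 2 * a * b; b ^+ 2 - c ^+ 2]); split=> [||i].
(* If all coefficients vanished, then [a^2 = b^2 = c^2] and [a b = 0], so [c^4 = 0]. *)
- apply/eqP => /polyP h; have := h 0%N; have := h 1%N; have := h 2%N.
  rewrite !coef_Poly !coef0/= => h2 h1 h0.
  have : a ^+ 2 * b ^+ 2 = 0 by have -> : a ^+ 2 * b ^+ 2 = (2 * a * b) ^+ 2 / 4; [field|rewrite h1 expr0n mul0r].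
  have -> : a ^+ 2 = c ^+ 2 by lra.
  have -> : b ^+ 2 = c ^+ 2 by lra.
  by apply/eqP; rewrite -exprD gt_eqF// exprn_gt0.
- exact: size_Poly.
rewrite wv ww -/a -/b => h; rewrite /root horner_Poly/=; apply/eqP.
by rewrite mul0r add0r -[RHS](subrr (c ^+ 2 * (1 + i%:R ^+ 2))) -{1}h; ring.
Qed.

End NullSections.

(** * Cap measure as a function of the cosine, and the inverse of [delta] *)

Section Angle.
Variables (R : realType) (n : nat) (mu : probability (Rn R n) R).
Hypothesis n0 : (0 < n)%N.
Hypothesis mu_unif : uniform_on_sphere mu.
Implicit Types (u v z : 'cV[R]_n).

Let measurable_cap u c : measurable (band u (capm c)).
Proof. by apply: measurable_band; exact: closed_capm. Qed.

Lemma capmeas_anti c c' : c <= c' -> capmeas mu c' <= capmeas mu c.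
Proof.
move=> cc'; rewrite -lee_fin -!(mu_capE n0 mu_unif _ (e0_sphere R n0)).
apply: le_measure; rewrite ?inE//.
by move=> v [vS h]; split=> //; exact: le_trans h.
Qed.

Lemma capmeas_le0 c : c <= 0 -> capmeas mu c = 1.
Proof.
move=> c0; rewrite /capmeas (_ : band _ _ = @sphere R n) ?mu_sphere//.
by apply/seteqP; split=> v /=; [case|split=> //; exact: le_trans c0 _].
Qed.

Lemma capmeas_gt1 c : 1 < c -> capmeas mu c = 0.
Proof.
move=> c1; rewrite /capmeas (_ : band _ _ = set0) ?measure0//.
apply/seteqP; split=> v //= -[vS] /(lt_le_trans c1).
by rewrite ltNge dot_le1//; exact: e0_sphere.
Qed.

Lemma capmeas1 : (1 < n)%N -> capmeas mu 1 = 0.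
Proof.
move=> n1; rewrite /capmeas (_ : mu _ = 0%E)//.
rewrite -(mu_circle0 n0 mu_unif n1 ler01); congr (mu _).
apply/seteqP; split=> v [vS h]; split=> //; last by move: h; rewrite /capm/= => ->.
by apply/eqP; rewrite eq_le h dot_le1//; exact: e0_sphere.
Qed.

(** An intermediate value argument for a nonincreasing function: [s] is the supremum of the cosines
    whose cap has measure at least [eps]. *)
Lemma capmeas_surj eps : (1 < n)%N -> 0 < eps < 1 ->
  exists2 s, 0 <= s <= 1 & capmeas mu s = eps.
Proof.
move=> n1 /andP[eps0 eps1]; pose E := [set c | eps <= capmeas mu c].
have E0 : E 0 by rewrite /E/= capmeas_le0// ltW.
have E1 : ubound E 1.
  move=> c /= Ec; rewrite leNgt; apply/negP => /capmeas_gt1 c0.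
  by move: Ec; rewrite /E/= c0 leNgt eps0.
have Eub : has_ubound E by exists 1.
pose s := sup E.
have s0 : 0 <= s by exact: ub_le_sup.
have s1 : s <= 1 by apply: ge_sup => //; exists 0.
have eS := e0_sphere R n0.
exists s; first by rewrite s0 s1.
apply/eqP; rewrite eq_le; apply/andP; split; last first.
  (* Closed caps with cosine increasing to [s] decrease to the cap of [s], so continuity from above
     gives [eps <= capmeas mu s]. *)
  have capI : \bigcap_k band (e0 R n) (capm (s - k.+1%:R^-1)) = band (e0 R n) (capm s).
    apply/seteqP; split=> v.
      move=> h; split; first by case: (h 0%N I).
      rewrite /capm/= -subr_le0; apply/ler_addgt0Pl => e e_gt0; rewrite addr0.
      rewrite lerBlDr -lerBlDl.
      have := archi_boundP (ltW (divr_gt0 ltr01 e_gt0)) .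
      set k := Num.bound _ => ke; have [_] := h k I; apply: le_trans.
      rewrite lerD2l lerN2 invf_ple ?posrE//.
      by move: ke; rewrite div1r => /ltW/le_trans; apply; rewrite ler_nat.
    move=> [vS h] k _; split=> //; apply: le_trans h.
    by rewrite lerBlDr lerDl ltW.
  rewrite -lee_fin -(mu_capE n0 mu_unif s eS) -capI.
  apply: (@cvge_ge _ _ eventually_filter); last first.
    apply: nonincreasing_cvg_mu => //.
    - exact: le_lt_trans (probability_le1 mu (measurable_cap _ _)) (ltry _).
    - by rewrite capI.
    move=> i j ij; apply/subsetPset => v [vS h]; split=> //; apply: le_trans h.
    by rewrite lerD2l lerN2 lef_pV2 ?posrE// ler_nat.
  apply: nearW => k /=; rewrite (mu_capE n0 mu_unif _ eS) lee_fin.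
  have [c Ec sc] : exists2 c, E c & s - k.+1%:R^-1 < c.
    by apply: sup_adherent => //; split=> //; exists 0.
  exact: le_trans Ec (capmeas_anti (ltW sc)).
(* For the other inequality, the caps [F k] have measure below [eps] and exhaust the cap of [s] up
   to its null boundary section. *)
pose F k := band (e0 R n) (capm (s + k.+1%:R^-1)).
have capU : band (e0 R n) (capm s) = (\bigcup_k F k) `|` band (e0 R n) [set t | `|t| = s].
  apply/seteqP; split=> v.
    move=> [vS]; rewrite /capm/= le_eqVlt => /predU1P[h|h]; first by right.
    left; have d0 : 0 < `|dot (e0 R n) v| - s by rewrite subr_gt0.
    have := archi_boundP (ltW (divr_gt0 ltr01 d0)).
    set k := Num.bound _ => kd; exists k => //; split=> //.
    rewrite /capm/= -lerBrDl invf_ple ?posrE//.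
    by move: kd; rewrite div1r => /ltW/le_trans; apply; rewrite ler_nat.
  move=> [[k _ [vS h]]|[vS h]]; split=> //; last by move: h; rewrite /capm/= => ->.
  by apply: le_trans h; rewrite lerDl ltW.
have mF : measurable (\bigcup_k F k) by apply: bigcup_measurable => k _; exact: measurable_cap.
rewrite -lee_fin -(mu_capE n0 mu_unif s eS) capU.
apply: le_trans (measureU2 _ _ _) _ => //.
  by apply: measurable_band; exact: closed_circle.
rewrite [X in (_ + X <= _)%E](mu_circle0 n0 mu_unif n1 s0) adde0.
apply: (@cvge_le _ _ eventually_filter); last first.
  apply: nondecreasing_cvg_mu => // [k|i j ij]; first exact: measurable_cap.
  apply/subsetPset => v [vS h]; split=> //.
  by apply: le_trans h; rewrite lerD2l lef_pV2 ?posrE// ler_nat.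
apply: nearW => k /=; rewrite (mu_capE n0 mu_unif _ eS) lee_fin.
rewrite leNgt; apply/negP => /ltW Ek.
have := ub_le_sup Eub Ek; rewrite -/s leNgt => /negP; apply.
by rewrite ltrDl.
Qed.

(** The range of [theta] fixes the signs of the cosines used later; the positivity allows division
    by [delta mu (theta / 4)] in [Bbound]. *)
Lemma delta_invP eps (theta := delta_inv mu eps) : 0 < eps < 1 ->
  0 <= theta <= pi / 2 /\ 0 < delta mu (theta / 4).
Proof.
move=> e01; have p0 : 0 < pi / 2 :> R by rewrite divr_gt0 ?pi_gt0.
have [n1|] := ltnP 1 n.
  have [s /andP[s0 s1] sE] := capmeas_surj n1 e01.
  have sI : -1 <= s <= 1 by rewrite s1 andbT; lra.
  have sP : s \in `[-1, 1] by rewrite in_itv/=.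
  have [tI tE] : 0 <= theta <= pi / 2 /\ delta mu theta = eps.
    apply: (@xgetPex _ 0 [set t | 0 <= t <= pi / 2 /\ delta mu t = eps]).
    exists (acos s); rewrite /= deltaE acosK//; split=> //; rewrite acos_ge0//=.
    rewrite leNgt; apply/negP; rewrite -ltr_cos ?in_itv/= ?acos_ge0 ?acos_lepi//.
      by rewrite acosK// cos_pihalf ltNge s0.
    by rewrite ltW//= ler_pdivrMr// ler_pMr ?pi_gt0// ler1n.
  split=> //; rewrite deltaE; apply: capmeas_gt0 => //.
  (* For [n > 1] the cap of angle 0 is null, whereas [delta mu theta = eps > 0]. *)
  have t0 : 0 < theta.
    rewrite lt_neqAle (andP tI).1 andbT; apply/eqP => t0.
    move: tE e01; rewrite deltaE -t0 cos0 capmeas1// => <-.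
    by rewrite ltxx.
  rewrite -[ltRHS](@cos0 R) ltr_cos ?in_itv/= ?lexx ?pi_ge0//; first by lra.
  by move: tI => /andP[_]; have := pi_ge0 R; lra.
(* If n = 1, all caps are the whole sphere, so [delta] never takes the value [eps]
   and [delta_inv] returns its default value 0. *)
rewrite leq_eqVlt ltnS leqn0 (gtn_eqF n0) orbF => /eqP n1.
have tI : 0 <= theta <= pi / 2.
  rewrite /theta /delta_inv; case: xgetP => [? _ []//|_].
  by rewrite lexx ltW.
split=> //; rewrite deltaE; apply: (@lt_le_trans _ _ 1) => //.
rewrite /capmeas (_ : band _ _ = @sphere R n) ?mu_sphere//.
apply/seteqP; split=> v; first by case.
move=> vS; split=> //; rewrite /capm/=; apply: le_trans (cos_le1 _) _.
have : `|dot (e0 R n) v| ^+ 2 = 1.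
  rewrite real_normK ?num_real//; move: vS => /sphereE; rewrite !dotE.
  subst n; rewrite !big_ord1 !mxE/= mul1r => <-; exact: expr2.
by move=> h; rewrite -(@ler_pXn2r _ 2) ?nnegrE// h expr1n.
Qed.

End Angle.

(** * Maximal separated families of points on the sphere *)

Section Packing.
Variables (R : realType) (n : nat) (mu : probability (Rn R n) R).
Hypothesis n0 : (0 < n)%N.
Hypothesis mu_unif : uniform_on_sphere mu.
Implicit Types (z : 'cV[R]_n) (s : seq 'cV[R]_n).

Definition packing (c : R) s :=
  all (fun z => `[< sphere z >]) s && pairwise (fun x y => `|dot x y| < c) s.

(** By [cap_trans], a point common to two of the caps of cosine [k] would bring their centres too
    close; the caps are disjoint and the overlap bound holds with 1. *)
Lemma packing_size (k : R) s : 0 <= k -> packing (2 * k ^+ 2 - 1) s ->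
  (size s)%:R * capmeas mu k <= 1.
Proof.
move=> k0 /andP[/allP sS /(pairwiseP 0) sep].
have nS (i : 'I_(size s)) : sphere (nth 0 s i) by apply/asboolP/sS/mem_nth.
have := @sum_measure_overlap R _ _ mu (size s) (fun i => band (nth 0 s i) (capm k)) 1.
rewrite (eq_bigr (fun=> (capmeas mu k)%:E)); last first.
  by move=> i _; rewrite (mu_capE n0 mu_unif)//; exact: nS.
rewrite sumEFin lee_fin sumr_const card_ord mulr_natl; apply.
  by move=> i; apply: measurable_band; exact: closed_capm.
move=> v; apply/card_le1_eqP => i j; rewrite !inE => iF jF.
suff h (a b : 'I_(size s)) : band (nth 0 s a) (capm k) v ->
    band (nth 0 s b) (capm k) v -> (a < b)%N -> False.
  by apply/val_inj; have [/(h _ _ iF jF)|/(h _ _ jF iF)|] := ltngtP (val i) (val j).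
move=> [vS av] [_ bv] ab.
have := sep a b; rewrite !inE => /(_ (ltn_ord a) (ltn_ord b) ab).
by rewrite ltNge (cap_trans k0 (nS a) (nS b) vS).
Qed.

(** Packing sizes are bounded through the measure of a cap, so a largest packing exists; a point it
    fails to cover could be added to it. *)
Lemma packing_cover (k : R) : 0 <= k -> 0 < capmeas mu k ->
  exists s, [/\ forall z, z \in s -> sphere z, (size s)%:R * capmeas mu k <= 1 &
    forall z, sphere z -> exists2 x, x \in s & 2 * k ^+ 2 - 1 <= `|dot x z|].
Proof.
move=> k0 mk; set c := 2 * k ^+ 2 - 1.
pose Q m := `[< exists2 s, packing c s & size s = m >].
have Q0 : exists m, Q m by exists 0%N; apply/asboolP; exists [::].
have Qub m : Q m -> (m <= Num.bound (capmeas mu k)^-1)%N.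
  move=> /asboolP[s /(packing_size k0) + <-].
  rewrite -ler_pdivlMr// div1r -(ler_nat R) => /le_trans; apply.
  by apply/ltW/archi_boundP; rewrite invr_ge0 ltW.
have [m /asboolP[s ps sm] maxm] := ex_maxnP Q0 Qub.
exists s; split; last 1 first.
- move=> z zS; apply: contrapT => h.
  suff /maxm : Q (size s).+1 by rewrite sm ltnn.
  apply/asboolP; exists (z :: s) => //; move: ps; rewrite /packing/= => /andP[-> ->].
  rewrite andbT asboolT//= andbT; apply/allP => x xs; rewrite ltNge dotC.
  by apply/negP => xz; apply: h; exists x.
- by move=> z zs; move: ps => /andP[/allP/(_ z zs)/asboolP].
- exact: packing_size.
Qed.

End Packing.

(** * Probability that no sample of a given mode falls in a given set *)

Section Sampling.
Variables (R : realType) (M N : nat) (d d' : measure_display).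
Variables (T : measurableType d) (Omega : measurableType d').
Variables (X : 'I_N -> Omega -> T) (S : 'I_N -> Omega -> 'I_M).
Hypothesis mX : forall i, measurable_fun setT (X i).
Hypothesis mS : forall i s, measurable [set w | S i w = s].

Lemma measurable_sample i (B : set T) s : measurable B ->
  measurable [set w | B (X i w) /\ S i w = s].
Proof.
move=> mB; apply: (measurableI (X i @^-1` B)); last exact: mS.
by rewrite -[X in measurable X]setTI; exact: mX.
Qed.

Lemma measurable_samples (Bs : 'I_N -> set T) (s : 'I_N -> 'I_M) :
  (forall i, measurable (Bs i)) ->
  measurable [set w | forall i, Bs i (X i w) /\ S i w = s i].
Proof.
move=> mB; rewrite (_ : mkset _ = \bigcap_i [set w | Bs i (X i w) /\ S i w = s i]).
  by apply: fin_bigcap_measurable => // i _; exact: measurable_sample.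
by apply/seteqP; split=> w /= h i; [move=> _; exact: h i|exact: h i I].
Qed.

Lemma measurable_miss (C : set T) (s0 : 'I_M) : measurable C ->
  measurable [set w | forall i, ~ (C (X i w) /\ S i w = s0)].
Proof.
move=> mC; rewrite (_ : mkset _ = \bigcap_i ~` [set w | C (X i w) /\ S i w = s0]).
  apply: fin_bigcap_measurable => // i _; apply: measurableC.
  exact: measurable_sample.
by apply/seteqP; split=> w /= h i; [move=> _; exact: h i|exact: h i I].
Qed.

Lemma miss_probability (mu : probability T R) (Pr : probability Omega R)
    (C : set T) (s0 : 'I_M) :
  (forall (Bs : 'I_N -> set T) (s : 'I_N -> 'I_M), (forall i, measurable (Bs i)) ->
     Pr [set w | forall i, Bs i (X i w) /\ S i w = s i] =
     (\prod_(i < N) (mu (Bs i) * (M%:R^-1)%:E))%E) ->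
  measurable C ->
  (Pr [set w | forall i, ~ (C (X i w) /\ S i w = s0)]
    <= ((1 - fine (mu C) / M%:R) ^+ N)%:E)%E.
Proof.
move=> iid mC.
have M0 : (M%:R : R) != 0 by rewrite pnatr_eq0 -lt0n (leq_ltn_trans _ (ltn_ord s0)).
(* The event is split by the sequence of observed modes, as the sampling law is given for prescribed
   modes. [D s] is where a sample of mode [s] may lie. *)
pose D (s : 'I_M) : set T := if s == s0 then ~` C else setT.
have mD s : measurable (D s) by rewrite /D; case: ifP => // _; exact: measurableC.
pose F (s : {ffun 'I_N -> 'I_M}) := [set w | forall i, D (s i) (X i w) /\ S i w = s i].
apply: (@le_trans _ _ (\sum_(s : {ffun 'I_N -> 'I_M}) Pr (F s))%E).
  apply: measure_finType_le; last 1 first.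
  - move=> w h; exists [ffun i => S i w] => // i; rewrite ffunE; split=> //.
    by rewrite /D; case: eqP => // Ss0 Cx; exact: h i (conj Cx Ss0).
  - by move=> s; exact: (measurable_samples (Bs := fun i => D (s i))).
  - exact: measurable_miss.
pose G s := fine (mu (D s)) / M%:R.
have PrF s : Pr (F s) = (\prod_(i < N) G (s i))%:E.
  rewrite (iid (fun i => D (s i)))// -prodEFin; apply: eq_bigr => i _.
  by rewrite /G EFinM fineK//; exact: fin_num_measure.
rewrite (eq_bigr _ (fun s _ => PrF s)) sumEFin lee_fin.
(* The sum over mode sequences factors into [N] equal sums over one mode: [(1 - mu C) / M] from [s0]
   and [1 / M] from each of the [M - 1] others. *)
rewrite -(bigA_distr_bigA (fun _ s => G s)) prodr_const card_ord.
rewrite (_ : \sum_s G s = 1 - fine (mu C) / M%:R)// (bigD1 s0)//=.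
rewrite (eq_bigr (fun=> M%:R^-1)); last first.
  by move=> s /negbTE ss0; rewrite /G /D ss0 (probability_setT mu) mul1r.
rewrite sumr_const cardC1 card_ord /G /D eqxx probability_setC// fineB//; last first.
  exact: fin_num_measure.
rewrite /= -[X in _ + X]mulr_natr -subn1 natrB ?lt0n -?(pnatr_eq0 R)//.
by field.
Qed.

End Sampling.

Theorem theorem1 (R : realType) (n m M N : nat)
  (A : 'I_M -> 'M[R]_n) (B : 'M[R]_(n, m))
  (mu : probability (Rn R n) R)
  (d : measure_display) (Omega : measurableType d)
  (Pr : probability Omega R)
  (X : 'I_N -> Omega -> Rn R n) (S : 'I_N -> Omega -> 'I_M)
  (tol eps : R) :
  (0 < n)%N -> (0 < m)%N -> (0 < M)%N ->
  uniform_on_sphere mu ->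
  (forall i, measurable_fun setT (X i)) ->
  (forall i s, measurable [set w | S i w = s]) ->
  (* the samples (X i, S i), i < N, are i.i.d. uniform on S x {1..M} *)
  (forall (Bs : 'I_N -> set (Rn R n)) (s : 'I_N -> 'I_M),
     (forall i, measurable (Bs i)) ->
     Pr [set w | forall i, Bs i (X i w) /\ S i w = s i] =
     (\prod_(i < N) (mu (Bs i) * (M%:R^-1)%:E))%E) ->
  0 < tol -> 0 < eps < 1 ->
  exists E : set Omega,
    [/\ measurable E,
        ((1 - Bbound mu M N eps)%:E <= Pr E)%E &
        forall w, E w ->
        forall (g : R) (P : 'M[R]_n) (K : 'M[R]_(m, n)),
          alg1_output A B (fun i => X i w : 'cV[R]_n) (fun i => S i w) tol g P K ->
          kappa P * (1 - cos (delta_inv mu eps)) < 1 ->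
          jsr A B K <= g / (1 - kappa P * (1 - cos (delta_inv mu eps)))].
Proof.
move=> n0 m0 M0 mu_unif mX mS iid tol0 e01.
set theta := delta_inv mu eps; set B0 := Bbound _ _ _ _.
have [/andP[t0 t1] d4] := delta_invP n0 mu_unif e01; rewrite -/theta in t0 t1 d4.
have pi0 := pi_gt0 R.
pose k4 := cos (theta / 4); pose k2 := cos (theta / 2).
have k4_ge0 : 0 <= k4 by apply: cos_ge0_pihalf; lra.
have k2_ge0 : 0 <= k2 by apply: cos_ge0_pihalf; lra.
have k24 : k2 = 2 * k4 ^+ 2 - 1.
  rewrite /k2 (_ : theta / 2 = (theta / 4) *+ 2); last by rewrite mulr2n; field.
  by rewrite cos_mulr2n mulr_natl.
have kt : cos theta = 2 * k2 ^+ 2 - 1.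
  rewrite (_ : theta = (theta / 2) *+ 2); last by rewrite mulr2n; field.
  by rewrite cos_mulr2n mulr_natl.
(* Disjoint caps of angle [theta / 4] bound the number of centres, and the centres cover the sphere
   within angle [theta / 2]. *)
have [zs [zsS szs cover]] := packing_cover n0 mu_unif k4_ge0 d4.
pose z (j : 'I_(size zs)) := nth 0 zs j.
have zS j : sphere (z j) by apply/zsS/mem_nth.
pose cap j := band (z j) (capm k2).
have mcap j : measurable (cap j) by apply: measurable_band; exact: closed_capm.
(* The bad events: no sample of mode [p.2] falls in the cap of angle [theta / 2] around centre
   [p.1]. *)
pose miss (p : 'I_(size zs) * 'I_M) :=
  [set w | forall i, ~ (cap p.1 (X i w) /\ S i w = p.2)].
have mmiss p : measurable (miss p) by exact: (measurable_miss mX mS).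
have mU : measurable (\bigcup_p miss p) by exact: fin_bigcup_measurable.
exists (~` \bigcup_p miss p); split.
- exact: measurableC.
- rewrite probability_setC// EFinB leeB//.
  apply: (le_trans (measure_finType_le Pr mmiss mU (@subset_refl _ _))).
  pose r := (1 - delta mu (theta / 2) / M%:R) ^+ N.
  have capE j : fine (mu (cap j)) = delta mu (theta / 2).
    by rewrite (mu_capE n0 mu_unif)//.
  have missE p : (Pr (miss p) <= r%:E)%E.
    by have := miss_probability mX mS p.2 iid (mcap p.1); rewrite capE.
  apply: (@le_trans _ _ (\sum_(p : 'I_(size zs) * 'I_M) r%:E)%E).
    by apply: lee_sum => p _; exact: missE.
  (* There are [size zs * M] bad events, each of probability at most [r], and
     [size zs <= 1 / delta mu (theta / 4)]. *)
  rewrite sumEFin lee_fin sumr_const card_prod !card_ord /B0 /Bbound -/theta -/r.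
  have r0 : 0 <= r.
    apply: exprn_ge0; rewrite subr_ge0 ler_pdivrMr ?ltr0n// mul1r.
    rewrite (@le_trans _ _ 1) ?ler1n// -lee_fin deltaE.
    by rewrite -(mu_capE n0 mu_unif _ (e0_sphere R n0)) probability_le1//;
      apply: measurable_band; exact: closed_capm.
  rewrite ler_pdivlMr// -[r *+ _]mulr_natr natrM.
  have : (size zs)%:R * delta mu (theta / 4) * (M%:R * r) <= 1 * (M%:R * r).
    by rewrite ler_wpM2r// mulr_ge0.
  by rewrite mul1r; congr (is_true (_ <= _)); ring.
move=> w Ew g P K; apply: alg1_jsr_le => // s v vS.
have [x xzs xv] := cover v vS.
have xi : (index x zs < size zs)%N by rewrite index_mem.
pose j := Ordinal xi; have zj : z j = x by rewrite /z/= nth_index.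
(* If no sample of mode [s] were within [theta] of [v], none could lie within [theta / 2] of the
   centre [x], since [x] is within [theta / 2] of [v]; then [w] would be in [miss (j, s)]. *)
apply: contrapT => h; apply: Ew; exists (j, s) => // i [[XS Xz] Si]; apply: h.
exists i; split=> //; rewrite kt; apply: (@cap_trans _ _ k2 _ _ (z j)) => //.
  by rewrite dotC.
by rewrite dotC zj k24.
Qed.
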